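(* Let $\Gamma$ be an abelian group, and let $A$ be an order with a $\Gamma$-grading $(B_\gamma)_{\gamma\in\Gamma}$. Then: (i) the nilradical $\sqrt{0_A}$ is a homogeneous ideal of $A$; (ii) $\mathrm{Id}(A)=\mathrm{Id}(B_1)$, and $A$ is connected if and only if $B_1$ is connected; (iii) if $B_1$ is connected, then each element of $\mu(A)$ is homogeneous.
   Context: All rings are commutative with identity. An order is a commutative ring $A$ whose additive group is isomorphic to $\mathbb{Z}^n$ for some integer $n\ge 0$. Let $\Gamma$ be a multiplicatively written abelian group with identity $1$. A $\Gamma$-grading of a ring $A$ is a system $(B_\gamma)_{\gamma\in\Gamma}$ of additive subgroups $B_\gamma\subset A$ such that $B_\gamma\cdot B_{\gamma'}\subset B_{\gamma\gamma'}$ for all $\gamma,\gamma'\in\Gamma$, and such that the map $\bigoplus_{\gamma\in\Gamma}B_\gamma\to A$, $(x_\gamma)_\gamma\mapsto\sum_\gamma x_\gamma$, is bijective. Then $B_1$ is a subring of $A$ containing the identity element of $A$. The nilradical $\sqrt{0_A}$ is the ideal of nilpotent elements of $A$. $\mathrm{Id}(R)=\{x\in R: x^2=x\}$ is the set of idempotents of a ring $R$; $R$ is called connected if $\#\mathrm{Id}(R)=2$ (equivalently, $\mathrm{Id}(R)=\{0,1\}$ and $R\ne 0$). $\mu(A)$ is the group of roots of unity of $A$, i.e. the elements $x\in A$ with $x^n=1$ for some integer $n>0$. An additive subgroup $H\subset A$ (in particular an ideal) is called homogeneous if for each $(x_\gamma)_{\gamma}\in\bigoplus_{\gamma\in\Gamma}B_\gamma$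 one has $\sum_\gamma x_\gamma\in H$ if and only if every $x_\gamma\in H$. An element of $A$ is called homogeneous if it belongs to $\bigcup_{\gamma\in\Gamma}B_\gamma$. *)

(* Defs.v *)
From mathcomp Require Import all_boot all_order all_algebra finmap.
From mathcomp Require Import mathcomp_extra boolp classical_sets functions.
From mathcomp Require Import cardinality.

Set Implicit Arguments.
Unset Strict Implicit.
Unset Printing Implicit Defensive.

Import GRing.Theory.

Local Open Scope classical_set_scope.
Local Open Scope card_scope.
Local Open Scope ring_scope.

(* Rings are [comPzRingType]s rather than [comNzRingType]s: the zero ring is an
   order (of rank n = 0), and it is not connected. *)

Definition is_order (A : comPzRingType) : Prop :=
  exists (n : nat) (f : {additive A -> 'rV[int]_n}), bijective f.

Section Grading.
Variables (Gamma : groupType) (A : comPzRingType).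
Implicit Type B : Gamma -> set A.

(* The external direct sum of the B g: finitely supported families
   (x g)_g with x g in B g. *)
Definition direct_sum B : set {fsfun Gamma -> A with 0} :=
  [set x : {fsfun Gamma -> A with 0} | forall g, B g (x g)].

Definition family_sum (x : {fsfun Gamma -> A with 0}) : A :=
  \sum_(g <- finsupp x) x g.

Definition is_grading B : Prop :=
  [/\ forall g, zmod_closed [in B g],
      forall g h x y, B g x -> B h y -> B (g * h)%g (x * y)
    & set_bij (direct_sum B) [set: A] family_sum].

Definition homogeneous_subset B (H : set A) : Prop :=
  forall x, direct_sum B x -> (H (family_sum x) <-> forall g, H (x g)).

Definition homogeneous_elt B (x : A) : Prop := (\bigcup_g B g) x.

End Grading.

Section Rings.
Variable A : comPzRingType.

(* [idealr_closed] is not used because it also demands that the ideal be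
   proper, which fails for the nilradical of the zero ring. *)
Definition is_ideal (I : set A) : Prop :=
  zmod_closed [in I] /\ forall a x, I x -> I (a * x).

Definition nilradical : set A := [set x | exists n : nat, x ^+ n = 0].

(* For a subring R of A, given by its carrier; [idempotents setT] and
   [connected_ring setT] are the notions for A itself. *)
Definition idempotents (R : set A) : set A := [set x | R x /\ x ^+ 2 = x].

Definition connected_ring (R : set A) : Prop := idempotents R #= `I_2.

Definition roots_of_unity : set A :=
  [set x | exists2 n : nat, (0 < n)%N & x ^+ n = 1].

End Rings.

Arguments nilradical : clear implicits.
Arguments roots_of_unity : clear implicits.

(* Main.v *)
Require Import Defs.
From HB Require Import structures.
From mathcomp Require Import all_boot all_order all_algebra all_field finmap.
From mathcomp Require Import mathcomp_extra boolp classical_sets functions.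
From mathcomp Require Import cardinality ring.

(* The group ring A[Gamma] consists of the finitely supported families on
   which the direct sum of the B g lives; that direct sum is a subring D, and
   the augmentation A[Gamma] -> A restricts to an isomorphism D -> A.  It is
   thus enough to describe the nilpotents, idempotents and roots of unity of
   A[Gamma].
   Simultaneous triangularization of the multiplication matrices of A yields
   ring morphisms s_i : A -> C which detect nilpotency and whose sum is
   integral.  They map A[Gamma] to C[Gamma], where the involution
   u^* = sum conj(u_g) g^-1 is positive: the coefficient of u u^* at 1 is
   sum |u_g|^2.  Hence C[Gamma] is reduced, its idempotents satisfy u^* = u and
   its roots of unity satisfy u u^* = 1.
   If x in A[Gamma] is idempotent (resp. a root of unity), then s_i maps
   a = x_1 (resp. a = x_g (x^-1)_(g^-1)) to sum |s_i(x_h)|^2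
   (resp. |s_i(x_g)|^2), a number in [0, 1].  The traces sum_i s_i(a)^k being
   nonincreasing natural numbers, each s_i(a) is 0 or 1 (the same for all i
   when A is connected, as a is idempotent modulo nilpotents).  So x is
   supported at one point modulo nilpotents, and then exactly, as idempotents
   and roots of unity that agree modulo nilpotents are equal. *)

Set Implicit Arguments.
Unset Strict Implicit.
Unset Printing Implicit Defensive.

Import Order.TTheory GRing.Theory Num.Theory.

Local Open Scope classical_set_scope.
Local Open Scope ring_scope.

(** * Complex characters of an order *)

Lemma trig_mulmx_diag (R : pzSemiRingType) n (M N : 'M[R]_n) i :
  is_trig_mx M -> is_trig_mx N -> (M *m N) i i = M i i * N i i.
Proof.
move=> /is_trig_mxP Mt /is_trig_mxP Nt.
rewrite mxE (bigD1 i)//= big1 ?addr0// => j; rewrite neq_ltn => /orP[ji|ij].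
- by rewrite Nt// mulr0.
- by rewrite Mt// mul0r.
Qed.

(** By Cayley-Hamilton: the characteristic polynomial is ['X ^+ n]. *)
Lemma trig_diag0_nilpotent (R : comNzRingType) n (M : 'M[R]_n) :
  is_trig_mx M -> (forall i, M i i = 0) -> M ^+ n = 0.
Proof.
case: n M => [|n] M; first by move=> *; exact: flatmx0.
move=> Mt M0; have := Cayley_Hamilton M; rewrite (char_poly_trig Mt).
under eq_bigr do rewrite M0 subr0.
by rewrite prodr_const card_ord rmorphXn /= horner_mx_X.
Qed.

(** In the family built below, the [s i a] are the eigenvalues, with multiplicity, of multiplication
    by [a]: if all vanish then [a] is nilpotent, and their sum is the trace of an integral
    matrix. *)
Definition separating_characters (A : comPzRingType) n
    (s : 'I_n -> {rmorphism A -> algC}) : Prop :=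
  (forall a, (forall i, s i a = 0) -> nilradical A a)
  /\ (forall a, \sum_i s i a \is a Num.int).

Section OrderCharacters.
Variables (A : comPzRingType) (n : nat).
Variables (f : {additive A -> 'rV[int]_n}) (g : {additive 'rV[int]_n -> A}).
Hypotheses (fK : cancel f g) (gK : cancel g f).

(** Multiplication by [a] in the Z-basis [g (delta_mx 0 i)], acting on row vectors; the entries are
    cast to [algC] so that eigenvalues exist. *)
Definition regular_mx (a : A) : 'M[algC]_n :=
  map_mx intr (\matrix_i f (a * g (delta_mx 0 i))).

Lemma regular_mxE v a :
  map_mx intr v *m regular_mx a = map_mx intr (f (a * g v)).
Proof.
rewrite -map_mxM; congr map_mx.
rewrite [in RHS](row_sum_delta v) raddf_sum mulr_sumr raddf_sum mulmx_sum_row.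
apply: eq_bigr => i _; rewrite rowK.
by rewrite -[v 0 i]intz !scaler_int raddfMz mulrzAr raddfMz.
Qed.

Lemma regular_mx_inj a b : regular_mx a = regular_mx b -> a = b.
Proof.
move=> ab; rewrite -[a]fK -[b]fK; congr (g _).
(* Faithfulness: both matrices are applied to the coordinates of 1. *)
have fab : map_mx intr (f a) = map_mx intr (f b) :> 'rV[algC]_n.
  by have := regular_mxE (f 1) a; rewrite ab regular_mxE fK !mulr1.
apply/matrixP => i j; apply: (@intr_inj algC).
by have /matrixP/(_ i j) := fab; rewrite !mxE.
Qed.

(** Integral row vectors include the standard basis, so the action on them determines the matrix;
    the ring identities below are read off from actions. *)
Lemma regular_mxP a (M : 'M[algC]_n) :
  (forall v, map_mx intr v *m M = map_mx intr (f (a * g v))) ->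
  M = regular_mx a.
Proof.
move=> aM; apply/row_matrixP => i; rewrite !rowE.
by rewrite -(map_delta_mx intr) aM regular_mxE.
Qed.

Lemma regular_mxB a b : regular_mx (a - b) = regular_mx a - regular_mx b.
Proof.
apply/esym/regular_mxP => v.
by rewrite mulmxBr !regular_mxE -map_mxB -raddfB -mulrBl.
Qed.

Lemma regular_mx1 : regular_mx 1 = 1%:M.
Proof. by apply/esym/regular_mxP => v; rewrite mul1r gK mulmx1. Qed.

Lemma regular_mxM a b : regular_mx (a * b) = regular_mx a *m regular_mx b.
Proof.
by apply/esym/regular_mxP => v; rewrite mulmxA !regular_mxE fK mulrCA mulrA.
Qed.

Lemma separating_characters_exist :
  exists s : 'I_n -> {rmorphism A -> algC}, separating_characters s.
Proof.
(* The matrices of the basis elements commute, so one unitary [P] triangularizes them all. *)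
have [|P /unitarymx_unit Pu /allP Pt] := @cotrigonalization algC n
   [seq regular_mx (g (delta_mx 0 j)) | j <- enum 'I_n].
  move=> _ _ /mapP[i _ ->] /mapP[j _ ->].
  by rewrite /comm_mx -!regular_mxM mulrC.
pose T a := P *m regular_mx a *m invmx P.
have TB : GRing.zmod_morphism T.
  by move=> a b; rewrite /T regular_mxB mulmxBr mulmxBl.
have T1 : T 1 = 1%:M by rewrite /T regular_mx1 mulmx1 mulmxV.
have TM a b : T (a * b) = T a *m T b.
  by rewrite /T regular_mxM !mulmxA mulmxKV.
pose TA : {additive A -> 'M[algC]_n} :=
  HB.pack T (GRing.isZmodMorphism.Build _ _ T TB).
(* [T a] is an integral combination of the triangular matrices of the basis elements. *)
have Tt a : is_trig_mx (T a).
  apply/is_trig_mxP => i j ij.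
  rewrite -[a]fK [f a]row_sum_delta raddf_sum -[T]/(TA : _ -> _).
  rewrite raddf_sum summxE big1// => k _.
  rewrite -[f a 0 k]intz scaler_int 2!raddfMz -scaler_int mxE.
  have : is_trig_mx (T (g (delta_mx 0 k))).
    by rewrite /T -conjumx//; apply: Pt; apply: map_f; rewrite mem_enum.
  by move=> /is_trig_mxP -> //; rewrite mulr0.
pose s i a := T a i i.
have sB i : GRing.zmod_morphism (s i) by move=> a b; rewrite /s TB !mxE.
have sM i : GRing.monoid_morphism (s i).
    split=> [|a b]; first by rewrite /s T1 mxE eqxx.
    by rewrite /s TM trig_mulmx_diag.
pose S i : {rmorphism A -> algC} := HB.pack (s i)
  (GRing.isZmodMorphism.Build _ _ _ (sB i))
  (GRing.isMonoidMorphism.Build _ _ _ (sM i)).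
exists S; split=> a /=.
  move=> sa0.
  have TX k : T (a ^+ k) = (T a) ^+ k.
    by elim: k => [|k IHk]; rewrite ?T1 // !exprS TM IHk.
  have Tm : T (a ^+ n) = 0 by rewrite TX trig_diag0_nilpotent.
  exists n; apply: regular_mx_inj.
  have -> : regular_mx 0 = 0 by rewrite -(subrr 1) regular_mxB subrr.
  have /(congr1 (fun M => invmx P *m M *m P)) := Tm.
  by rewrite /T !mulmxA mulVmx// mul1mx mulmxKV// mulmx0 mul0mx.
(* The trace is unchanged by conjugation, and [regular_mx a] has integral entries. *)
rewrite -/(\tr (T a)) mxtrace_mulC mulmxA mulVmx// mul1mx.
by apply: rpred_sum => i _; rewrite !mxE intr_int.
Qed.
End OrderCharacters.

Lemma order_characters (A : comPzRingType) : is_order A ->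
  exists n (s : 'I_n -> {rmorphism A -> algC}), separating_characters s.
Proof.
move=> [n [f [g fK gK]]]; exists n.
pose gA : {additive 'rV[int]_n -> A} :=
  HB.pack g (GRing.isZmodMorphism.Build _ _ g (can2_additive fK gK)).
exact: (@separating_characters_exist A n f gA).
Qed.

Lemma order_torsion_free (A : comPzRingType) : is_order A ->
  forall n (a : A), (0 < n)%N -> a *+ n = 0 -> a = 0.
Proof.
move=> [m [f /bij_inj f_inj]] n a n0 an; apply: f_inj; apply/matrixP => i j.
have /matrixP/(_ i j)/eqP : f a *+ n = 0 by rewrite -raddfMn an raddf0.
rewrite raddf0 mulmxnE !mxE mulrn_eq0 (gtn_eqF n0) => /eqP.
by [].
Qed.

Lemma connected_ringP (A : comPzRingType) (R : set A) : R 0 -> R 1 ->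
  connected_ring R ->
  (1 : A) <> 0 /\ forall e, idempotents R e -> e = 0 \/ e = 1.
Proof.
move=> R0 R1 /card_set_bijP[f [f_to f_inj f_surj]].
have I0 : idempotents R 0 by split=> //; rewrite expr0n.
have I1 : idempotents R 1 by split=> //; rewrite expr1n.
have A_neq0 : (1 : A) <> 0.
  move=> A0; have [x _ fx] := f_surj 0%N isT; have [y _ fy] := f_surj 1%N isT.
  have : x = y by rewrite -[x]mul1r -[y]mul1r A0 !mul0r.
  by move=> xy; rewrite -xy fx in fy.
split=> // e Ie.
have f01 : f 0 <> f 1 by move=> /f_inj; rewrite !inE => /(_ I0 I1)/esym.
(* The distinct values [f 0] and [f 1] exhaust the two-element target. *)
have [|] : f e = f 0 \/ f e = f 1.
- move: (f_to _ I0) (f_to _ I1) (f_to _ Ie) f01 => /=.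
  by case: (f 0) (f 1) (f e) => [|[|?]] [|[|?]] [|[|?]] //=; auto.
- by move=> /f_inj; rewrite !inE; left; auto.
- by move=> /f_inj; rewrite !inE; right; auto.
Qed.

(** * Nilpotents and idempotents *)

Section Nilradical.
Variable A : comPzRingType.
Implicit Types a b x y d e : A.

Lemma nilradical0 : nilradical A 0. Proof. by exists 1%N. Qed.

Lemma nilradicalM a b : nilradical A b -> nilradical A (a * b).
Proof. by move=> [n bn]; exists n; rewrite exprMn bn mulr0. Qed.

Lemma nilradicalD a b : nilradical A a -> nilradical A b -> nilradical A (a + b).
Proof.
move=> [m am] [n bn]; exists (m + n)%N; rewrite exprDn big1// => -[i /=].
rewrite ltnS => imn _; have [ni|/ltnW ni] := leqP n i.
  by rewrite -(subnK ni) [b ^+ _]exprD bn mulr0 mulr0 mul0rn.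
have mi : (m <= m + n - i)%N by rewrite -addnBA// leq_addr.
by rewrite -(subnK mi) exprD am mulr0 mul0r mul0rn.
Qed.

Lemma nilradicalB a b : nilradical A a -> nilradical A b -> nilradical A (a - b).
Proof. by move=> a0 b0; rewrite -mulN1r; exact/nilradicalD/nilradicalM. Qed.

Lemma nilradical_sum (I : Type) (r : seq I) (P : pred I) (F : I -> A) :
  (forall i, P i -> nilradical A (F i)) ->
  nilradical A (\sum_(i <- r | P i) F i).
Proof.
by move=> Fn; apply: big_ind => //; [exact: nilradical0|exact: nilradicalD].
Qed.

Lemma nilradical_ideal : is_ideal (nilradical A).
Proof.
split; last by move=> *; exact: nilradicalM.
split; first by rewrite inE; exact: nilradical0.
by move=> a b; rewrite !inE; exact: nilradicalB.
Qed.

(** For idempotents, [d = x - y] satisfies d^3 = d, hence d = d^(2k+1) for every k. *)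
Lemma idempotent_eq_mod_nilradical x y :
  x ^+ 2 = x -> y ^+ 2 = y -> nilradical A (x - y) -> x = y.
Proof.
move=> xx yy [n dn]; apply/eqP; rewrite -subr_eq0; set d := x - y in dn *.
have d3 : d * d ^+ 2 = d.
  transitivity (x ^+ 2 * x - x ^+ 2 * y *+ 3 + x * y ^+ 2 *+ 3 - y ^+ 2 * y).
    by rewrite /d; ring.
  by rewrite xx yy -!expr2 xx yy /d; ring.
have dk k : d = d * (d ^+ 2) ^+ k.
  by elim: k => [|k IHk]; rewrite ?mulr1// exprS mulrA d3.
by rewrite (dk n) -exprM mulnC exprM dn expr2 mulr0 mulr0.
Qed.

(** Expanding [x ^+ n] around [y] gives n d = d^2 t for [d = x - y]. If d^(m+2) = 0, then n d^(m+1)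
    = 0, and the absence of n-torsion lowers the exponent until d = 0. *)
Lemma root_of_unity_eq_mod_nilradical x y n :
  (forall a, a *+ n = 0 -> a = 0) -> (0 < n)%N ->
  x ^+ n = 1 -> y ^+ n = 1 -> nilradical A (x - y) -> x = y.
Proof.
move=> tf n0 xn yn [m dm]; apply/eqP; rewrite -subr_eq0; apply/eqP.
set d := x - y in dm *.
have [t dt] : exists t, d *+ n = d ^+ 2 * t.
  have taylor k : exists t,
      x ^+ k.+1 = y ^+ k.+1 + d * y ^+ k *+ k.+1 + d ^+ 2 * t.
    have xE : x = y + d by rewrite /d; ring.
    rewrite xE; elim: k => [|k [t xt]]; first by exists 0; ring.
    exists ((y + d) * t + y ^+ k *+ k.+1).
    by rewrite exprS xt !exprS [in RHS]mulrS; ring.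
  case: n n0 xn yn {tf} => // n _ xn yn; have [t] := taylor n.
  rewrite xn yn -addrA => /esym/eqP; rewrite -subr_eq0 addrAC subrr add0r.
  rewrite addr_eq0 => /eqP dt; exists (- (t * y)).
  have -> : d *+ n.+1 = y * (d * y ^+ n *+ n.+1).
    by rewrite mulrnAr mulrCA -exprS yn mulr1.
  by rewrite dt; ring.
elim: m dm => [|[|m] IHm] dm.
- by rewrite -[d]mulr1 -(expr0 d) dm mulr0.
- exact: dm.
- apply: IHm; apply: tf.
  by rewrite exprSr -mulrnAr dt mulrA -exprD addn2 dm mul0r.
Qed.

(** Lifting of idempotents: [a] and [1 - a] are comaximal, hence so are their n-th powers. In u a^n
    + v (1 - a)^n = 1 the two summands have product 0, so each is idempotent. *)
Lemma idempotent_mod_nilradical a :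
  (forall e, e ^+ 2 = e -> e = 0 \/ e = 1) -> nilradical A (a ^+ 2 - a) ->
  nilradical A a \/ nilradical A (1 - a).
Proof.
move=> conn [n an].
have [u [v uv]] : exists u v, u * a ^+ n + v * (1 - a) ^+ n = 1.
  have comax x y k : (exists u v, u * x + v * y = 1) ->
      exists u v, u * x ^+ k + v * y = 1.
    move=> [u [v uv]]; elim: k => [|k [u' [v' uv']]].
      by exists 1, 0; rewrite mulr1 mul0r addr0.
    exists (u * u'), (u' * x ^+ k * v + v').
    by rewrite -[RHS]uv' -[X in _ = X * _ + _]mulr1 -uv exprS; ring.
  have [|u [v uv]] := comax (1 - a) a n; last first.
    by apply: comax; exists v, u; rewrite addrC.
  by exists 1, 1; ring.
set e := u * a ^+ n in uv; set f := v * (1 - a) ^+ n in uv.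
have ef : e * f = 0.
  have -> : e * f = u * v * (a * (1 - a)) ^+ n by rewrite exprMn /e /f; ring.
  have -> : a * (1 - a) = - (a ^+ 2 - a) by ring.
  by rewrite exprNn an !mulr0.
have ee : e ^+ 2 = e by rewrite -[RHS]mulr1 -uv mulrDr ef addr0 expr2.
(* If [e = 0] then [f = 1], and a^n = a^n f is a multiple of (a (1 - a))^n = 0; the case [e = 1] is
   symmetric. *)
have [e0|e1] := conn e ee; [left|right]; exists n.
- move: uv; rewrite e0 add0r => f1.
  have : a ^+ n * f = v * (a * (1 - a)) ^+ n by rewrite exprMn /f; ring.
  have -> : a * (1 - a) = - (a ^+ 2 - a) by ring.
  by rewrite f1 mulr1 exprNn an !mulr0.
- have : (1 - a) ^+ n * e = u * (a * (1 - a)) ^+ n by rewrite exprMn /e; ring.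
  have -> : a * (1 - a) = - (a ^+ 2 - a) by ring.
  by rewrite e1 mulr1 exprNn an !mulr0.
Qed.

End Nilradical.

(** * Group rings *)

(* The phantom proof that Gamma is abelian makes the commutative ring structure
   on the type inferable. *)
Definition group_ring (Gamma : groupType)
  of (forall g h : Gamma, (g * h = h * g)%g) := fun R : comPzRingType =>
  {fsfun Gamma -> R with 0}.

Section GroupRing.
Variables (Gamma : groupType) (mulgC : forall g h : Gamma, (g * h = h * g)%g).
Variable R : comPzRingType.

Local Notation RG := (group_ring mulgC R).

HB.instance Definition _ := Choice.on RG.

Implicit Types (u v w : RG) (g h k : Gamma) (a b : R) (S T : {fset Gamma}).

Definition gr0 : RG := [fsfun].
Definition gr_opp u : RG := [fsfun g in finsupp u => - u g].
Definition gr_add u v : RG :=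
  [fsfun g in (finsupp u `|` finsupp v)%fset => u g + v g].

Lemma gr0E g : gr0 g = 0. Proof. by rewrite fsfunE. Qed.

Lemma gr_oppE u g : gr_opp u g = - u g.
Proof. by rewrite fsfunE; case: finsuppP => //; rewrite oppr0. Qed.

Lemma gr_addE u v g : gr_add u v g = u g + v g.
Proof.
by rewrite fsfunE inE; do 2!case: finsuppP => //= *; rewrite ?addr0 ?add0r.
Qed.

Lemma gr_addA : associative gr_add.
Proof. by move=> u v w; apply/fsfunP => g; rewrite !gr_addE addrA. Qed.

Lemma gr_addC : commutative gr_add.
Proof. by move=> u v; apply/fsfunP => g; rewrite !gr_addE addrC. Qed.

Lemma gr_add0 : left_id gr0 gr_add.
Proof. by move=> u; apply/fsfunP => g; rewrite gr_addE gr0E add0r. Qed.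

Lemma gr_addN : left_inverse gr0 gr_opp gr_add.
Proof.
by move=> u; apply/fsfunP => g; rewrite gr_addE gr_oppE gr0E addNr.
Qed.

HB.instance Definition _ :=
  GRing.isZmodule.Build RG gr_addA gr_addC gr_add0 gr_addN.

Definition coef g u : R := u g.

Fact coef_is_zmod_morphism g : GRing.zmod_morphism (coef g).
Proof. by move=> u v; rewrite /coef gr_addE gr_oppE. Qed.

HB.instance Definition _ g :=
  GRing.isZmodMorphism.Build RG R (coef g) (coef_is_zmod_morphism g).

Lemma gr_ext u v : coef^~ u =1 coef^~ v -> u = v.
Proof. by move=> uv; apply/fsfunP => g; exact: uv. Qed.

Definition mono g a : RG := [fsfun h in [fset g]%fset => a].

Lemma coef_mono g a h : coef h (mono g a) = if h == g then a else 0.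
Proof. by rewrite /coef fsfunE inE. Qed.

Fact mono_is_zmod_morphism g : GRing.zmod_morphism (mono g).
Proof.
move=> a b; apply: gr_ext => h; rewrite raddfB/= !coef_mono.
by case: eqP => //; rewrite subr0.
Qed.

HB.instance Definition _ g :=
  GRing.isZmodMorphism.Build R RG (mono g) (mono_is_zmod_morphism g).

Section Extension.
Variables (V : zmodType) (F : Gamma -> {additive R -> V}).

(** The universal property of the direct sum of copies of [R]; [augmentation], [gr_map] and [star]
    are instances. *)
Definition gr_lin u : V := \sum_(g <- finsupp u) F g (coef g u).

(** Lets elements with different supports be summed over a common index set. *)
Lemma gr_linE S u : (finsupp u `<=` S)%fset ->
  gr_lin u = \sum_(g <- S) F g (coef g u).
Proof.
move=> uS; rewrite /gr_lin (big_fset_incl _ uS)// => g _ gu.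
by rewrite /coef fsfun_dflt// raddf0.
Qed.

Fact gr_lin_is_zmod_morphism : GRing.zmod_morphism gr_lin.
Proof.
move=> u v; pose S := (finsupp u `|` finsupp v `|` finsupp (u - v))%fset.
rewrite !(@gr_linE S) /S; first last.
- exact: fsubsetUr.
- by rewrite -fsetUA fsubsetUl.
- by rewrite fsetUAC fsubsetUr.
by rewrite -sumrB; apply: eq_bigr => g _; rewrite !raddfB.
Qed.

HB.instance Definition _ :=
  GRing.isZmodMorphism.Build RG V gr_lin gr_lin_is_zmod_morphism.

Lemma gr_lin_mono g a : gr_lin (mono g a) = F g a.
Proof.
rewrite (@gr_linE [fset g]%fset) ?finsupp_sub// big_seq_fset1.
by rewrite coef_mono eqxx.
Qed.

End Extension.

Lemma gr_sum_mono u : u = \sum_(g <- finsupp u) mono g (coef g u).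
Proof.
apply: gr_ext => h; rewrite raddf_sum /=.
under eq_bigr do rewrite coef_mono.
rewrite -big_mkcond /=; have [hu|hu] := finsuppP u h.
  rewrite /coef fsfun_dflt// big_seq_cond big1// => g /andP[gu /eqP hg].
  by rewrite hg gu in hu.
rewrite -big_filter (perm_big [:: h]) ?big_seq1//.
apply: uniq_perm; rewrite ?filter_uniq ?fset_uniq// => g.
by rewrite mem_filter inE eq_sym; case: eqP => // ->.
Qed.

Lemma gr_ind (P : RG -> Prop) : P 0 -> (forall g a, P (mono g a)) ->
  (forall u v, P u -> P v -> P (u + v)) -> forall u, P u.
Proof. by move=> P0 Pm PD u; rewrite [u]gr_sum_mono; exact: big_ind. Qed.


Definition gr1 : RG := mono 1%g 1.
Definition gr_mul u v : RG :=
  \sum_(g <- finsupp u) \sum_(h <- finsupp v) mono (g * h)%g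
    (coef g u * coef h v).

Lemma gr_mulE S T u v : (finsupp u `<=` S)%fset -> (finsupp v `<=` T)%fset ->
  gr_mul u v = \sum_(g <- S) \sum_(h <- T) mono (g * h)%g (coef g u * coef h v).
Proof.
move=> uS vT; rewrite /gr_mul (big_fset_incl _ uS)/=; last first.
  move=> g _ gu; rewrite big1// => h _.
  by rewrite {1}/coef fsfun_dflt// mul0r raddf0.
apply: eq_bigr => g _; rewrite (big_fset_incl _ vT)// => h _ hv.
by rewrite [coef h v]/coef fsfun_dflt// mulr0 raddf0.
Qed.

Lemma gr_mul_mono g h a b :
  gr_mul (mono g a) (mono h b) = mono (g * h)%g (a * b).
Proof.
rewrite (@gr_mulE [fset g]%fset [fset h]%fset) ?finsupp_sub//.
by rewrite !big_seq_fset1 !coef_mono !eqxx.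
Qed.

Lemma gr_mulC : commutative gr_mul.
Proof.
move=> u v; rewrite /gr_mul exchange_big/=.
by do 2!apply: eq_bigr => ? _; rewrite mulgC mulrC.
Qed.

Lemma gr_mulDl : left_distributive gr_mul +%R.
Proof.
move=> u v w; pose S := (finsupp u `|` finsupp v `|` finsupp (u + v)%R)%fset.
rewrite !(@gr_mulE S (finsupp w))// /S; first last.
- exact: fsubsetUr.
- by rewrite -fsetUA fsubsetUl.
- by rewrite fsetUAC fsubsetUr.
rewrite -big_split; apply: eq_bigr => g _; rewrite -big_split/=.
by apply: eq_bigr => h _; rewrite raddfD mulrDl raddfD.
Qed.

Lemma gr_mulDr : right_distributive gr_mul +%R.
Proof. by move=> u v w; rewrite gr_mulC gr_mulDl !(gr_mulC u). Qed.

Lemma gr_mul0 : left_zero 0 gr_mul.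
Proof.
by move=> u; apply: (@addrI _ (gr_mul 0 u)); rewrite -gr_mulDl !addr0.
Qed.

Lemma gr_mulr0 : right_zero 0 gr_mul.
Proof. by move=> u; rewrite gr_mulC gr_mul0. Qed.

Lemma gr_mul1 : left_id gr1 gr_mul.
Proof.
elim/gr_ind => [|g a|u v uE vE]; first exact: gr_mulr0.
- by rewrite gr_mul_mono mul1g mul1r.
- by rewrite gr_mulDr uE vE.
Qed.

Lemma gr_mulA : associative gr_mul.
Proof.
elim/gr_ind => [v w|g a|u u' IHu IHu' v w].
- by rewrite !gr_mul0.
- elim/gr_ind => [w|h b|v v' IHv IHv' w].
  + by rewrite !(gr_mul0, gr_mulr0).
  + elim/gr_ind => [|k c|w w' IHw IHw'].
    * by rewrite !gr_mulr0.
    * by rewrite !gr_mul_mono mulgA mulrA.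
    * by rewrite !gr_mulDr IHw IHw'.
  + by rewrite !(gr_mulDl, gr_mulDr) IHv IHv'.
- by rewrite !gr_mulDl IHu IHu'.
Qed.

HB.instance Definition _ := GRing.Zmodule_isComPzRing.Build RG
  gr_mulA gr_mulC gr_mul1 gr_mulDl.

Lemma monoM g h a b : mono g a * mono h b = mono (g * h)%g (a * b).
Proof. exact: gr_mul_mono. Qed.

Lemma mono1 : mono 1%g 1 = 1. Proof. by []. Qed.

Lemma monoX g a n : mono g a ^+ n = mono (g ^+ n)%g (a ^+ n).
Proof. by elim: n => [|n IHn]; rewrite ?mono1// !exprS IHn monoM expgS. Qed.

Lemma coefM u v h : coef h (u * v) =
  \sum_(g <- finsupp u) coef g u * coef (g^-1 * h)%g v.
Proof.
elim/gr_ind: v => [|k b|v w vE wE].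
- by rewrite mulr0 raddf0 big1// => g _; rewrite raddf0 mulr0.
- rewrite {1}[u]gr_sum_mono mulr_suml raddf_sum /=; apply: eq_bigr => g _.
  rewrite monoM !coef_mono; have -> : (g^-1 * h == k)%g = (h == g * k)%g.
    by apply/eqP/eqP => [<-|->]; rewrite mulgA ?mulgV ?mulVg mul1g.
  by case: ifP => //; rewrite mulr0.
- by rewrite mulrDr raddfD/= vE wE -big_split; apply: eq_bigr => g _;
    rewrite raddfD mulrDr.
Qed.

Lemma coefM_mono u g b h : coef h (u * mono g b) = coef (h / g)%g u * b.
Proof.
elim/gr_ind: u => [|k a|u v uE vE]; first by rewrite mul0r !raddf0 mul0r.
- by rewrite monoM !coef_mono divg_eq; case: ifP => //; rewrite mul0r.
- by rewrite mulrDl !raddfD/= mulrDl uE vE.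
Qed.

(** Both sides are biadditive and monomials generate the group ring additively. *)
Lemma gr_multiplicative_ext (V : pzRingType) (F : {additive RG -> V}) :
  (forall g h a b, F (mono g a * mono h b) = F (mono g a) * F (mono h b)) ->
  {morph F : u v / u * v}.
Proof.
move=> FM; elim/gr_ind => [v|g a|u u' IHu IHu' v].
- by rewrite !(mul0r, raddf0).
- elim/gr_ind => [|h b|v v' IHv IHv'].
  + by rewrite !(mulr0, raddf0).
  + exact: FM.
  + by rewrite mulrDr !raddfD mulrDr IHv IHv'.
- by rewrite mulrDl !raddfD mulrDl IHu IHu'.
Qed.

(** Convertible to [family_sum], which ties gradings to the group ring. *)
Definition augmentation : RG -> R := gr_lin (fun=> idfun).

Lemma augmentation_mono g a : augmentation (mono g a) = a.
Proof. exact: gr_lin_mono. Qed.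

HB.instance Definition _ := GRing.Additive.on augmentation.

Fact augmentation_is_monoid_morphism : GRing.monoid_morphism augmentation.
Proof.
split=> [|u v]; first by rewrite -mono1 augmentation_mono.
apply: gr_multiplicative_ext => g h a b /=.
by rewrite monoM !augmentation_mono.
Qed.

HB.instance Definition _ :=
  GRing.isMonoidMorphism.Build RG R augmentation augmentation_is_monoid_morphism.

End GroupRing.

(** * Functoriality of the group ring in its coefficients *)

Section GroupRingMap.
Variables (Gamma : groupType) (mulgC : forall g h : Gamma, (g * h = h * g)%g).
Variables (R R' : comPzRingType) (s : {rmorphism R -> R'}).

Local Notation RG := (group_ring mulgC R).
Local Notation RG' := (group_ring mulgC R').

Definition gr_map : RG -> RG' := gr_lin (fun g => mono mulgC g \o s).

Lemma gr_map_mono g a : gr_map (mono _ g a) = mono _ g (s a).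
Proof. exact: gr_lin_mono. Qed.

HB.instance Definition _ := GRing.Additive.on gr_map.

Fact gr_map_is_monoid_morphism : GRing.monoid_morphism gr_map.
Proof.
split=> [|u v]; first by rewrite -mono1 gr_map_mono rmorph1.
apply: gr_multiplicative_ext => g h a b /=.
by rewrite monoM !gr_map_mono monoM rmorphM.
Qed.

HB.instance Definition _ :=
  GRing.isMonoidMorphism.Build RG RG' gr_map gr_map_is_monoid_morphism.

Lemma coef_gr_map g u : coef g (gr_map u) = s (coef g u).
Proof.
elim/gr_ind: u => [|h a|u v uE vE]; first by rewrite !raddf0.
- by rewrite gr_map_mono !coef_mono; case: ifP; rewrite ?rmorph0.
- by rewrite !raddfD/= uE vE.
Qed.

End GroupRingMap.

(** * The positive involution on the complex group algebra *)

Section Star.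
Variables (Gamma : groupType) (mulgC : forall g h : Gamma, (g * h = h * g)%g).

Local Notation CG := (group_ring mulgC algC).

Implicit Types u : CG.

Definition star : CG -> CG := gr_lin (fun g => mono mulgC g^-1%g \o Num.conj).

Lemma star_mono g a : star (mono _ g a) = mono _ g^-1%g a^*.
Proof. exact: gr_lin_mono. Qed.

HB.instance Definition _ := GRing.Additive.on star.

Fact star_is_monoid_morphism : GRing.monoid_morphism star.
Proof.
split=> [|u v]; first by rewrite -mono1 star_mono invg1 conjC1.
apply: gr_multiplicative_ext => g h a b /=.
by rewrite monoM !star_mono monoM rmorphM invgM mulgC.
Qed.

HB.instance Definition _ :=
  GRing.isMonoidMorphism.Build CG CG star star_is_monoid_morphism.

Lemma starK : involutive star.
Proof.
elim/gr_ind => [|h a|u v uE vE]; first by rewrite !raddf0.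
- by rewrite !star_mono invgK conjCK.
- by rewrite !raddfD/= uE vE.
Qed.

Lemma coef_star g u : coef g (star u) = (coef g^-1%g u)^*.
Proof.
elim/gr_ind: u => [|h a|u v uE vE]; first by rewrite !raddf0.
- by rewrite star_mono !coef_mono eqg_invLR; case: ifP; rewrite ?rmorph0.
- by rewrite !raddfD/= uE vE.
Qed.

(** The term at [g] is split off, being 0 when [g] is outside the support, so that both the bound by
    a single term and its equality case can be read off. *)
Lemma coef1_mul_star g u : coef 1%g (u * star u) =
  `|coef g u| ^+ 2 + \sum_(h <- (finsupp u `\ g)%fset) `|coef h u| ^+ 2.
Proof.
have -> : coef 1%g (u * star u) = \sum_(h <- finsupp u) `|coef h u| ^+ 2.
  by rewrite coefM; apply: eq_bigr => h _; rewrite mulg1 coef_star invgK normCK.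
have [gu|gu] := boolP (g \in finsupp u); first by rewrite (big_fsetD1 g).
by rewrite {2}/coef fsfun_dflt// normr0 expr0n add0r mem_fsetD1.
Qed.

Lemma coef1_mul_star_ge g u : `|coef g u| ^+ 2 <= coef 1%g (u * star u).
Proof.
by rewrite (coef1_mul_star g) lerDl sumr_ge0// => h _; rewrite exprn_ge0.
Qed.

Lemma coef1_mul_star_ge0 u : 0 <= coef 1%g (u * star u).
Proof. by apply: le_trans (coef1_mul_star_ge 1%g u); rewrite exprn_ge0. Qed.

Lemma coef1_mul_star_eq g u :
  `|coef g u| ^+ 2 = coef 1%g (u * star u) -> u = mono _ g (coef g u).
Proof.
rewrite (coef1_mul_star g) => /eqP; rewrite -subr_eq0 opprD addrA subrr add0r.
rewrite oppr_eq0 psumr_eq0; last by move=> h _; rewrite exprn_ge0.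
move=> /allP u0; apply: gr_ext => h; rewrite coef_mono.
case: eqP => [->//|/eqP hg]; have [hu|hu] := boolP (h \in finsupp u).
  have := u0 h; rewrite !inE hg hu sqrf_eq0 normr_eq0 => /(_ isT)/eqP.
  by [].
by rewrite /coef fsfun_dflt.
Qed.

Lemma mul_star_eq0 u : coef 1%g (u * star u) = 0 -> u = 0.
Proof.
move=> u0; apply: gr_ext => g; rewrite raddf0; apply/eqP.
by rewrite -normr_eq0 -sqrf_eq0 eq_le exprn_ge0// -u0 coef1_mul_star_ge.
Qed.

(** If v^2 = 0, then p = [v * star v] is self-adjoint with [p * star p] = p^2 = 0; positivity gives
    p = 0, and then v = 0. *)
Lemma group_algebra_reduced u n : u ^+ n = 0 -> u = 0.
Proof.
have sq0 (v : CG) : v ^+ 2 = 0 -> v = 0.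
  move=> v0; apply: mul_star_eq0; suff -> : v * star v = 0 by rewrite raddf0.
  apply: mul_star_eq0; rewrite rmorphM/= starK mulrC [star v * v]mulrC.
  by rewrite -expr2 exprMn v0 mul0r raddf0.
(* The exponent is raised to a power of 2, so that squares can be peeled off. *)
suff pow2 k : u ^+ (2 ^ k) = 0 -> u = 0.
  move=> un; apply: (pow2 n).
  by rewrite -(subnK (ltnW (ltn_expl n _)))// exprD un mulr0.
by elim: k => // k IHk; rewrite expnSr exprM => /sq0.
Qed.

(** The element [u - u * star u] times its star contains the factor [u - u ^+ 2] = 0, so
    [u = u * star u], which is self-adjoint. *)
Lemma idempotent_star u : u ^+ 2 = u -> star u = u.
Proof.
move=> uu; have su : star u ^+ 2 = star u by rewrite -rmorphXn/= uu.
have u1 : u * star u = u.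
  apply/esym/eqP; rewrite -subr_eq0; apply/eqP; apply: mul_star_eq0.
  suff -> : (u - u * star u) * star (u - u * star u) = 0 by rewrite raddf0.
  rewrite rmorphB rmorphM/= starK.
  transitivity ((u - u ^+ 2) * (star u - star u ^+ 2)); first by ring.
  by rewrite uu subrr mul0r.
by rewrite -[in LHS]u1 rmorphM/= starK mulrC u1.
Qed.

Lemma root_of_unity_mul_star u n : (0 < n)%N -> u ^+ n = 1 -> u * star u = 1.
Proof.
move=> n0 un; set P := u * star u.
have Pn : P ^+ n = 1 by rewrite exprMn -rmorphXn/= un rmorph1 mulr1.
have Ps : star P = P by rewrite rmorphM/= starK mulrC.
set w := P - 1; have ws : star w = w by rewrite rmorphB rmorph1/= Ps.
(* [P ^+ k * (w * star w)] has the form [v * star v], so the coefficients at 1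
   of the terms of [w * star w * (1 + P + ... + P ^+ n.-1) = 0] are nonnegative. *)
have Pw k : 0 <= coef 1%g (P ^+ k * (w * star w)).
  (* With Q the power of P to half of k, rounded down, v is [Q * w] for even k; for odd k the extra
     factor [P = u * star u] makes it [u * Q * w]. *)
  rewrite -[k]odd_double_half exprD -muln2 exprM.
  case: (odd k); rewrite /= ?expr0 ?expr1 ?mul1r.
    set Q := P ^+ _; have Qs : star Q = Q by rewrite rmorphXn/= Ps.
    suff -> : P * Q ^+ 2 * (w * star w) = (u * Q * w) * star (u * Q * w).
      exact: coef1_mul_star_ge0.
    by rewrite !rmorphM/= Qs /P; ring.
  set Q := P ^+ _; have Qs : star Q = Q by rewrite rmorphXn/= Ps.
  suff -> : Q ^+ 2 * (w * star w) = (Q * w) * star (Q * w).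
    exact: coef1_mul_star_ge0.
  by rewrite !rmorphM/= Qs; ring.
suff /mul_star_eq0/eqP : coef 1%g (w * star w) = 0.
  by rewrite subr_eq0 => /eqP.
have : coef 1%g ((\sum_(k < n) P ^+ k) * w * star w) = 0.
  by rewrite [_ * w]mulrC -subrX1 Pn subrr mul0r raddf0.
rewrite -mulrA mulr_suml raddf_sum/= => /eqP.
rewrite psumr_eq0 => [/allP/(_ (Ordinal n0))|k _]; last exact: Pw.
by rewrite mem_index_enum expr0 mul1r => /(_ isT)/eqP.
Qed.

End Star.

(** A strict decrease at every step would make [m] negative after [m 0] + 1 steps. *)
Lemma nonincreasing_nat_stalls (m : nat -> nat) :
  (forall k, m k.+1 <= m k)%N -> exists k, m k.+1 = m k.
Proof.
move=> mS; apply/not_existsP => mN.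
have mlt k : (m k + k <= m 0)%N.
  elim: k => [|k IHk]; first by rewrite addn0.
  rewrite addnS -addSn (leq_trans _ IHk)// leq_add2r ltn_neqAle mS andbT.
  exact/eqP/mN.
by have := mlt (m 0).+1; rewrite addnS ltnNge leq_addl.
Qed.

(** * Group rings of orders *)

Section OrderGroupRing.
Variables (A : comPzRingType) (A_order : is_order A).
Variables (n : nat) (s : 'I_n -> {rmorphism A -> algC}).
Hypothesis s_sep : separating_characters s.

(* The traces of the powers of [a] are natural numbers that decrease, so two
   consecutive ones agree. *)
Lemma characters_in_01 a : (forall i, 0 <= s i a <= 1) ->
  forall i, s i a = 0 \/ s i a = 1.
Proof.
move=> a01.
have step i k : s i (a ^+ k.+1) <= s i (a ^+ k).
  have /andP[a0 a1] := a01 i.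
  by rewrite exprS rmorphM rmorphXn/= ler_piMl// exprn_ge0.
have trN k : exists m : nat, \sum_i s i (a ^+ k) = m%:R.
  apply/natrP; rewrite natrEint s_sep.2 sumr_ge0// => i _.
  by rewrite rmorphXn exprn_ge0//; case/andP: (a01 i).
have [m mE] := choice trN.
have [k mk] : exists k, m k.+1 = m k.
  apply: nonincreasing_nat_stalls => k.
  by rewrite -(ler_nat algC) -!mE; apply: ler_sum => i _.
(* Equality of two consecutive traces kills each nonnegative term t^k (1 - t), where t = [s i a]. *)
move=> i; have : \sum_i (s i (a ^+ k) - s i (a ^+ k.+1)) = 0.
  by rewrite sumrB !mE mk subrr.
move/eqP; rewrite psumr_eq0 => [/allP/(_ i)|j _]; last by rewrite subr_ge0.
rewrite mem_index_enum exprSr rmorphM/= -[X in X - _]mulr1 -mulrBr mulf_eq0.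
move=> /(_ isT)/orP[|]; last by rewrite subr_eq0 => /eqP; right.
by rewrite rmorphXn expf_eq0 => /andP[_ /eqP]; left.
Qed.

Variables (Gamma : groupType) (mulgC : forall g h : Gamma, (g * h = h * g)%g).
Local Notation AG := (group_ring mulgC A).
Implicit Types x y : AG.

(** The images of [x] in the reduced ring C[Gamma] vanish, so every [s i] kills the coefficients of
    [x]. *)
Lemma nilradical_coef x : nilradical AG x -> forall g, nilradical A (coef g x).
Proof.
move=> [k xk] g; apply: s_sep.1 => i; rewrite -coef_gr_map.
suff -> : gr_map (s i) x = 0 by rewrite raddf0.
by apply: (@group_algebra_reduced _ _ _ k); rewrite -rmorphXn/= xk rmorph0.
Qed.

Lemma coef_nilradical x :
  (forall g, nilradical A (coef g x)) -> nilradical AG x.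
Proof.
move=> xn; rewrite [x]gr_sum_mono; apply: nilradical_sum => g _.
by have [k xk] := xn g; exists k; rewrite monoX xk raddf0.
Qed.

Lemma gr_map_eq_mod_nilradical x y :
  (forall i, gr_map (s i) x = gr_map (s i) y) -> nilradical AG (x - y).
Proof.
move=> xy; apply: coef_nilradical => g; apply: s_sep.1 => i.
by rewrite -coef_gr_map rmorphB/= xy subrr raddf0.
Qed.

Lemma gr_map_augmentation x i :
  s i (augmentation x) = augmentation (gr_map (s i) x).
Proof.
elim/gr_ind: x => [|g a|u v uE vE]; first by rewrite !rmorph0.
- by rewrite gr_map_mono !augmentation_mono.
- by rewrite !rmorphD/= uE vE.
Qed.

Lemma idempotent_group_ring x :
  x ^+ 2 = x -> x = mono mulgC 1%g (augmentation x).
Proof.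
move=> xx; apply: idempotent_eq_mod_nilradical => //.
  by rewrite monoX expg1n -rmorphXn/= xx.
pose X i := gr_map (s i) x.
have XX i : X i ^+ 2 = X i by rewrite -rmorphXn/= xx.
have X1 i : coef 1%g (X i) = coef 1%g (X i * star (X i)).
  by rewrite idempotent_star// -expr2 XX.
have x01 : forall i, 0 <= s i (coef 1%g x) <= 1.
  (* The coefficient c of [X i] at 1 satisfies c >= 0 and c^2 <= c. *)
  move=> i; rewrite -coef_gr_map -/(X i).
  have X0 : 0 <= coef 1%g (X i) by rewrite X1 coef1_mul_star_ge0.
  rewrite X0 /=; have := coef1_mul_star_ge 1%g (X i).
  rewrite -X1 ger0_norm// expr2; have [->|XN0] := eqVneq (coef 1%g (X i)) 0.
    by rewrite ler01.
  by rewrite ger_pMl// lt0r XN0.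
apply: gr_map_eq_mod_nilradical => i; rewrite gr_map_mono gr_map_augmentation.
(* As c is 0 or 1, c^2 = c: the equality case concentrates [X i] at 1. *)
rewrite -/(X i) [X i](@coef1_mul_star_eq _ _ 1%g) ?augmentation_mono//.
rewrite -X1 coef_gr_map.
by case: (characters_in_01 x01 i) => ->; rewrite ?normr0 ?normr1 ?expr0n ?expr1n.
Qed.

Lemma root_of_unity_group_ring x k :
    (forall e : A, e ^+ 2 = e -> e = 0 \/ e = 1) -> (1 : A) <> 0 ->
    (0 < k)%N -> x ^+ k = 1 ->
  exists g, x = mono mulgC g (augmentation x).
Proof.
move=> conn A_neq0 k0 xk.
pose X i := gr_map (s i) x.
have Xk i : X i ^+ k = 1 by rewrite -rmorphXn/= xk rmorph1.
have XX i : X i * star (X i) = 1 by exact: root_of_unity_mul_star (Xk i).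
(* [x ^+ k.-1] is the inverse of [x], and its image under [s i] is [star (X i)]. *)
pose y g := coef g x * coef g^-1%g (x ^+ k.-1).
have sy i g : s i (y g) = `|coef g (X i)| ^+ 2.
  have starX : star (X i) = gr_map (s i) (x ^+ k.-1).
    have xk1 : gr_map (s i) (x ^+ k.-1) * X i = 1.
      by rewrite -rmorphM/= -exprSr prednK// xk rmorph1.
    by rewrite -[LHS]mul1r -xk1 -mulrA XX mulr1.
  rewrite rmorphM/= -!coef_gr_map -starX coef_star invgK normCK.
  by [].
have y01 g : forall i, 0 <= s i (y g) <= 1.
  move=> i; rewrite sy exprn_ge0//= (le_trans (coef1_mul_star_ge g (X i)))//.
  by rewrite XX -mono1 coef_mono eqxx.
(* [y g] is idempotent modulo nilpotents, so by connectedness [y g] or [1 - y g] is nilpotent, which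
   fixes the value for all [i] at once. *)
have y_const g : (forall i, s i (y g) = 0) \/ (forall i, s i (y g) = 1).
  have [|[m ym]|[m ym]] := @idempotent_mod_nilradical A (y g) conn.
  - apply: s_sep.1 => i; rewrite rmorphB rmorphXn.
    by case: (characters_in_01 (y01 g) i) => ->; rewrite ?expr0n ?expr1n subrr.
  - left=> i; have := congr1 (s i) ym; rewrite rmorphXn rmorph0.
    by move=> /eqP; rewrite expf_eq0 => /andP[_ /eqP].
  - right=> i; have := congr1 (s i) ym; rewrite rmorphXn rmorph0 rmorphB rmorph1.
    by move=> /eqP; rewrite expf_eq0 subr_eq0 => /andP[_ /eqP].
(* Without characters, 1 would be nilpotent. *)
have [i0 _] : exists i0 : 'I_n, True.
  apply/not_existsP => nI; apply: A_neq0.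
  have [m] : nilradical A 1 by apply: s_sep.1 => i; case: (nI i).
  by rewrite expr1n.
have [g Xg] : exists g, coef g (X i0) <> 0.
  apply/not_existsP => X0; have : X i0 = 0.
    by apply: gr_ext => g; rewrite raddf0; exact: contrapT.
  move=> X00; have := Xk i0.
  rewrite X00 expr0n (gtn_eqF k0) => /(congr1 (coef 1%g)).
  by rewrite -mono1 coef_mono eqxx raddf0 => /esym/eqP; rewrite oner_eq0.
(* The value at [i0] is nonzero, so the same [g] serves every character. *)
have {}y1 i : s i (y g) = 1.
  case: (y_const g) => // /(_ i0)/eqP; rewrite sy sqrf_eq0 normr_eq0.
  by move=> /eqP.
have XE i : X i = mono _ g (s i (augmentation x)).
  have Xg1 : X i = mono _ g (coef g (X i)).
    by apply: coef1_mul_star_eq; rewrite -sy y1 XX -mono1 coef_mono eqxx.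
  by rewrite gr_map_augmentation -/(X i) {2}Xg1 augmentation_mono.
have ek : augmentation x ^+ k = 1 by rewrite -rmorphXn/= xk rmorph1.
(* Otherwise the monomial [X i0 ^+ k] would have coefficient 0 at the identity. *)
have gk : (g ^+ k = 1)%g.
  apply/eqP; rewrite eq_sym; apply/negPn/negP => gk.
  have := congr1 (coef 1%g) (Xk i0).
  rewrite XE monoX -mono1 !coef_mono eqxx (negPf gk) => /esym/eqP.
  by rewrite oner_eq0.
exists g; apply: (@root_of_unity_eq_mod_nilradical _ _ _ k) => //.
- move=> u uk; apply: gr_ext => h; rewrite raddf0.
  by apply: (order_torsion_free A_order k0); rewrite -raddfMn uk raddf0.
- by rewrite monoX gk ek.
- by apply: gr_map_eq_mod_nilradical => i; rewrite gr_map_mono -XE.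
Qed.

End OrderGroupRing.

(** * Gradings *)

Section Gradings.
Variables (Gamma : groupType) (mulgC : forall g h : Gamma, (g * h = h * g)%g).
Variables (A : comPzRingType) (B : Gamma -> set A) (B_grading : is_grading B).
Local Notation AG := (group_ring mulgC A).
Implicit Types x y : AG.

Lemma grading0 g : B g 0.
Proof. by have [/(_ g)[+ _] _ _] := B_grading; rewrite inE. Qed.

Lemma gradingB g a b : B g a -> B g b -> B g (a - b).
Proof.
have [/(_ g)[_ +] _ _] := B_grading => /(_ a b).
by rewrite !inE => BB Ba Bb; exact: BB.
Qed.

Lemma gradingD g a b : B g a -> B g b -> B g (a + b).
Proof.
move=> Ba Bb; rewrite -[b]opprK; apply: gradingB => //.
by rewrite -sub0r; exact/gradingB/Bb/grading0.
Qed.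

Lemma direct_sum_mono g a : B g a -> direct_sum B (mono mulgC g a).
Proof.
move=> Ba h; rewrite -/(coef h (mono mulgC g a)) coef_mono.
by case: eqP => [->//|_]; exact: grading0.
Qed.

Lemma direct_sumM x y :
  direct_sum B x -> direct_sum B y -> direct_sum B (x * y : AG).
Proof.
move=> Bx By h; rewrite -/(coef h (x * y)) coefM.
apply: big_ind => [||g _]; [exact: grading0|exact: gradingD|].
have [_ BM _] := B_grading.
by have := BM _ _ _ _ (Bx g) (By (g^-1 * h)%g); rewrite mulgA mulgV mul1g.
Qed.

Lemma augmentation_surj a : exists2 x : AG, direct_sum B x & augmentation x = a.
Proof. by have [_ _ [_ _ /(_ a Logic.I)[x Bx <-]]] := B_grading; exists x. Qed.

Lemma augmentation_inj x y : direct_sum B x -> direct_sum B y ->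
  augmentation x = augmentation y -> x = y.
Proof.
move=> Bx By xy; have [_ _ [_ + _]] := B_grading.
by apply => //; rewrite inE.
Qed.

(** If the family d sums to 1, then d times a homogeneous monomial in the direct sum equals that
    monomial. Comparing coefficients, the component of d at the identity acts as 1 on every
    homogeneous element, hence on [A]. *)
Lemma grading1 : B 1%g 1.
Proof.
have [d Bd d1] := augmentation_surj 1.
suff d_id a : coef 1%g d * a = a by rewrite -(d_id 1) mulr1; exact: Bd.
have [x Bx <-] := augmentation_surj a.
rewrite mulr_sumr; apply: eq_bigr => g _.
have Bg := direct_sum_mono (Bx g).
have /(congr1 (coef g)) : d * mono mulgC g (x g) = mono mulgC g (x g).
  apply: augmentation_inj => //; first exact: direct_sumM.
  by rewrite rmorphM/= d1 mul1r.
by rewrite coefM_mono mulgV coef_mono eqxx.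
Qed.

Lemma direct_sum1 : direct_sum B (1 : AG).
Proof. by rewrite -mono1; exact/direct_sum_mono/grading1. Qed.

Lemma direct_sumX x n : direct_sum B x -> direct_sum B (x ^+ n : AG).
Proof.
move=> Bx; elim: n => [|n IHn]; first exact: direct_sum1.
by rewrite exprS; exact: direct_sumM.
Qed.

Hypothesis A_order : is_order A.

Lemma nilradical_homogeneous : homogeneous_subset B (nilradical A).
Proof.
have [n [s s_sep]] := order_characters A_order.
move=> x Bx; rewrite -[family_sum x]/(augmentation (x : AG)); split.
  move=> [k xk]; apply: (nilradical_coef s_sep); exists k.
  (* Nilpotency lifts: [x ^+ k] lies in the direct sum and has augmentation 0. *)
  apply: augmentation_inj; [exact: direct_sumX| |by rewrite rmorph0 rmorphXn].
  by rewrite -(raddf0 (mono mulgC 1%g)); exact/direct_sum_mono/grading0.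
by move=> xn; apply: nilradical_sum => g _; exact: xn.
Qed.

Lemma idempotents_grading1 : idempotents [set: A] = idempotents (B 1%g).
Proof.
have [n [s s_sep]] := order_characters A_order.
apply/seteqP; split=> e [_ ee]; split=> //.
have [x Bx xe] := augmentation_surj e.
have xx : x ^+ 2 = x.
  apply: augmentation_inj => //; first exact: direct_sumX.
  by rewrite rmorphXn/= xe.
(* The lift is concentrated at 1, so [e] is its component in [B 1%g]. *)
have /(congr1 (coef 1%g)) := idempotent_group_ring s_sep xx.
by rewrite coef_mono eqxx xe => <-; exact: Bx.
Qed.

Lemma root_of_unity_homogeneous : connected_ring (B 1%g) ->
  forall a, roots_of_unity A a -> homogeneous_elt B a.
Proof.
have [n [s s_sep]] := order_characters A_order.
move=> /(connected_ringP (grading0 _) grading1)[A_neq0 conn] a [k k0 ak].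
have [x Bx xa] := augmentation_surj a.
have xk : x ^+ k = 1.
  apply: augmentation_inj; [exact: direct_sumX|exact: direct_sum1|].
  by rewrite rmorph1 rmorphXn/= xa.
have [e ee|g xg] := root_of_unity_group_ring A_order s_sep _ A_neq0 k0 xk.
  by apply: conn; rewrite -idempotents_grading1.
exists g => //; rewrite -xa.
(* The only component of the lift is [a] itself, at [g]. *)
have := Bx g; rewrite -[x g]/(coef g x) xg coef_mono eqxx.
by rewrite -xg.
Qed.

End Gradings.

Theorem theorem1p5 (Gamma : groupType)
  (Gamma_abelian : forall g h : Gamma, (g * h = h * g)%g)
  (A : comPzRingType) (A_order : is_order A)
  (B : Gamma -> set A) (B_grading : is_grading B) :
  [/\ is_ideal (nilradical A) /\ homogeneous_subset B (nilradical A),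
      idempotents [set: A] = idempotents (B 1%g)
        /\ (connected_ring [set: A] <-> connected_ring (B 1%g))
    & connected_ring (B 1%g) ->
        forall x, roots_of_unity A x -> homogeneous_elt B x].
Proof.
split; [split|split|].
- exact: nilradical_ideal.
- exact: (nilradical_homogeneous Gamma_abelian).
- exact: (idempotents_grading1 Gamma_abelian).
- by rewrite /connected_ring (idempotents_grading1 Gamma_abelian B_grading).
- exact: (root_of_unity_homogeneous Gamma_abelian).
Qed.
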